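(* Let $n(2,k)$ be the largest integer $n$ for which there exists a set $A$ of $k$ nonnegative integers such that $\{0,1,2,\ldots,n-1\}\subseteq 2A=\{a+a' : a,a'\in A\}$. Then \[ \limsup_{k\to\infty}\frac{n(2,k)}{k^2}\le 0.4789 . \]
   Context: For a set $A$ of integers, $2A=\{a+a' : a,a'\in A\}$ denotes its sumset. For a set $A$ of nonnegative integers, $n(2,A)=\max\{n : \{0,1,\ldots,n-1\}\subseteq 2A\}$, and $n(2,k)=\max\{n(2,A): A\subseteq \mathbb{N}_0,\ |A|=k\}$. *)

(* Defs.v *)
From mathcomp Require Import all_boot all_order all_algebra finmap.
From mathcomp Require Import all_classical all_reals all_analysis.

Set Implicit Arguments.
Unset Strict Implicit.
Unset Printing Implicit Defensive.

Local Open Scope nat_scope.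

Definition sumset2 (A : {fset nat}) : {fset nat} :=
  [fset (a + b)%N | a in A, b in A]%fset.

Definition covers (A : {fset nat}) (n : nat) : Prop :=
  forall i, i < n -> i \in sumset2 A.

Definition coverable (k : nat) : pred nat :=
  fun n => `[< exists A : {fset nat}, #|` A| = k /\ covers A n >].

Lemma coverable0 (k : nat) : exists n, coverable k n.
Proof.
exists 0; apply/asboolP; exists [fset i in iota 0 k]%fset; split => //.
by rewrite card_fseq undup_id ?iota_uniq // size_iota.
Qed.

Lemma coverable_bound (k n : nat) : coverable k n -> n <= k * k.
Proof.
move=> /asboolP[A [cardA covA]].
have sub : {subset iota 0 n <= [seq a + b | a <- A, b <- A]}.
  move=> i; rewrite mem_iota add0n => /= /covA /imfset2P[a aA [b bA ->]].
  by apply/allpairsP; exists (a, b).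
by have := uniq_leq_size (iota_uniq 0 n) sub; rewrite size_iota size_allpairs cardA.
Qed.

(* n(2,k): the largest n such that {0, ..., n-1} is contained in A + A for
   some set A of k nonnegative integers. *)
Definition n2 (k : nat) : nat := ex_maxn (coverable0 k) (@coverable_bound k).

Lemma n2P (k : nat) :
  (exists A : {fset nat}, #|` A| = k /\ covers A (n2 k)) /\
  (forall (n : nat) (A : {fset nat}), #|` A| = k -> covers A n -> n <= n2 k).
Proof.
rewrite /n2; case: ex_maxnP => m /asboolP Hm max; split=> // n A cA cov.
by apply: max; apply/asboolP; exists A.
Qed.

(* Main.v *)
(* Fourier analysis on Z/n, after Moser and Klotz. Let A be contained in
   [0, n), with k elements, and A + A contain [0, n). Counting ordered pairs,
   the excess M = k^2 + 2k - 2n bounds both the number of pairs with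
   a + b >= n and |f(r)|^2, where f(r) is the sum of e(r a / n) over a in A and
   0 < r < n. Cut the circle into four arcs symmetrically about 1/2, and let
   p1, ..., p4 be the numbers of elements of A in them. Pairs from opposite
   arcs overflow n, so (p3 + p4)^2 + 2 p2 p4 <= M; and a trigonometric
   polynomial without constant term, bounded below by m_j on the j-th arc,
   gives m_1 p1 + ... + m_4 p4 <= sqrt M times the sum of the moduli of its
   coefficients. Three such polynomials suffice to force M >= 0.0422 k^2,
   that is n <= 0.4789 k^2 + k. *)
Require Import Defs.
From Stdlib Require Import ZArith.
From mathcomp Require Import all_boot all_order all_algebra finmap.
From mathcomp Require Import all_classical all_reals all_analysis.
From mathcomp Require Import ssrZ ring lra.

Set Implicit Arguments.
Unset Strict Implicit.
Unset Printing Implicit Defensive.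

Import Order.TTheory GRing.Theory Num.Theory.
Local Open Scope ring_scope.

(** * Integer polynomials and certificates of nonnegativity on [0, 1] *)

(** Coefficients are kept in the binary [Z], so that certificates are decided by computation; [ZtoR]
    carries the outcome to the reals. *)
Definition ZtoR (R : realType) : Z -> R := intr \o int_of_Z.
Arguments ZtoR {R} z : simpl never.

Lemma ZtoRD (R : realType) : {morph @ZtoR R : x y / x + y}.
Proof. by move=> x y; rewrite /ZtoR /= rmorphD rmorphD. Qed.

Lemma ZtoRM (R : realType) : {morph @ZtoR R : x y / x * y}.
Proof. by move=> x y; rewrite /ZtoR /= rmorphM rmorphM. Qed.

Lemma ZtoRX (R : realType) n : {morph @ZtoR R : x / x ^+ n}.
Proof. by move=> x; rewrite /ZtoR /= rmorphXn rmorphXn. Qed.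

Lemma ZtoR0 (R : realType) : ZtoR 0 = 0 :> R.
Proof. by []. Qed.

Lemma ZtoRN1 (R : realType) : ZtoR (- 1) = -1 :> R.
Proof. by []. Qed.

Lemma ZtoRN (R : realType) : {morph @ZtoR R : x / - x}.
Proof. by move=> x; rewrite /ZtoR /= !rmorphN. Qed.

Lemma ZtoR_nat (R : realType) n : ZtoR n%:R = n%:R :> R.
Proof. by rewrite /ZtoR /= !rmorph_nat. Qed.

Lemma ZtoR_ge0 (R : realType) (z : Z) : 0 <= z -> 0 <= ZtoR z :> R.
Proof. by case: z => [|p|p] //= _; rewrite /ZtoR /= ler0z. Qed.

Lemma ler_ZtoR (R : realType) (x y : Z) : x <= y -> ZtoR x <= ZtoR y :> R.
Proof.
by rewrite -subr_ge0 => /(@ZtoR_ge0 R); rewrite ZtoRD -mulN1r ZtoRM ZtoRN1 mulN1r subr_ge0.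
Qed.

Fixpoint zadd (p q : seq Z) : seq Z :=
  match p, q with
  | [::], _ => q
  | _, [::] => p
  | x :: p', y :: q' => x + y :: zadd p' q'
  end.

Fixpoint zmul (p q : seq Z) : seq Z :=
  if p is x :: p' then zadd [seq x * y | y <- q] (0 :: zmul p' q) else [::].

Fixpoint zhorner (R : realType) (p : seq Z) (t : R) : R :=
  if p is x :: p' then ZtoR x + t * zhorner p' t else 0.

Lemma zhorner_add (R : realType) p q (t : R) :
  zhorner (zadd p q) t = zhorner p t + zhorner q t.
Proof.
elim: p q => [|x p IH] [|y q] /=; rewrite ?add0r ?addr0 //.
by rewrite IH ZtoRD; ring.
Qed.

Lemma zhorner_scale (R : realType) x q (t : R) :
  zhorner [seq x * y | y <- q] t = ZtoR x * zhorner q t.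
Proof. by elim: q => [|y q IH] /=; rewrite ?mulr0 // IH ZtoRM; ring. Qed.

Lemma zhorner_mul (R : realType) p q (t : R) :
  zhorner (zmul p q) t = zhorner p t * zhorner q t.
Proof.
elim: p => [|x p IH]; first by rewrite mul0r.
rewrite -[zmul _ _]/(zadd [seq x * y | y <- q] (0 :: zmul p q)).
by rewrite zhorner_add zhorner_scale /= IH ZtoR0; ring.
Qed.

(** The power of 2 clears the denominators of p(t / 2) without changing its sign. *)
Fixpoint zhalf (p : seq Z) : seq Z :=
  if p is x :: p' then x * 2 ^+ size p :: zhalf p' else [::].

Lemma zhorner_half (R : realType) p (t : R) :
  zhorner (zhalf p) t = 2 ^+ size p * zhorner p (t / 2).
Proof.
elim: p => [|x p IH] /=; first by rewrite mulr0.
by rewrite IH ZtoRM ZtoRX (_ : ZtoR 2 = 2) // exprS; field.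
Qed.

Fixpoint zshift (p : seq Z) : seq Z :=
  if p is x :: p' then zadd [:: x] (zadd (zshift p') (0 :: zshift p')) else [::].

Lemma zhorner_shift (R : realType) p (t : R) :
  zhorner (zshift p) t = zhorner p (1 + t).
Proof.
elim: p => [|x p IH] //.
rewrite -[zshift _]/(zadd [:: x] (zadd (zshift p) (0 :: zshift p))).
by rewrite !zhorner_add /= IH ZtoR0; ring.
Qed.

(** Horner's scheme for lower bounds: if 0 <= t <= 1 and q(t) >= m, then t q(t) >= min(0, m). *)
Fixpoint zlow (p : seq Z) : Z := if p is x :: p' then x + Z.min 0 (zlow p') else 0.

Lemma zlowP (R : realType) p (t : R) : 0 <= t <= 1 -> ZtoR (zlow p) <= zhorner p t.
Proof.
move=> t01; elim: p => [|x p IH] //=; rewrite ZtoRD lerD2l.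
have [low_ge0|low_lt0] := lerP 0 (zlow p).
  rewrite Z.min_l ?ZtoR0; last exact/Z.leb_le.
  by rewrite mulr_ge0 ?(le_trans _ IH) ?ZtoR_ge0 //; case/andP: t01.
rewrite Z.min_r; last by apply/Z.lt_le_incl/Z.ltb_lt.
case/andP: t01 => t_ge0 t_le1.
have low_le0 : ZtoR (zlow p) <= 0 :> R by rewrite -(ZtoR0 R) ler_ZtoR ?ltW.
have : 0 <= t * (zhorner p t - ZtoR (zlow p)) by rewrite mulr_ge0 ?subr_ge0.
have : 0 <= (1 - t) * (- ZtoR (zlow p)) by rewrite mulr_ge0 ?subr_ge0 ?oppr_ge0.
lra.
Qed.

(* Certifies nonnegativity on [0, 1] by bisection: both halves of the interval
   are rescaled to [0, 1]. *)
Fixpoint znonneg (d : nat) (p : seq Z) : bool :=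
  (0 <= zlow p) ||
  (if d is d'.+1 then let q := zhalf p in znonneg d' q && znonneg d' (zshift q)
   else false).

Lemma znonnegP (R : realType) d p (t : R) :
  znonneg d p -> 0 <= t <= 1 -> 0 <= zhorner p t.
Proof.
elim: d p t => [|d IH] p t /=; rewrite ?orbF.
  by move=> low /zlowP-/(_ p); apply: le_trans; rewrite ZtoR_ge0.
case/orP => [low /zlowP-/(_ p)|/andP[left right] /andP[t_ge0 t_le1]].
  by apply: le_trans; rewrite ZtoR_ge0.
rewrite -(@pmulr_rge0 _ (2 ^+ size p)) ?exprn_gt0 //.
have [t_le|t_ge] := lerP t (1 / 2).
  have -> : t = (2 * t) / 2 by field.
  by rewrite -zhorner_half IH //; lra.
have -> : t = (1 + (2 * t - 1)) / 2 by field.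
by rewrite -zhorner_half -zhorner_shift IH //; lra.
Qed.

(** * Trigonometric polynomials and their minima on the four arcs *)

(* For h = [(a_1, b_1); ...; (a_d, b_d)], x = 1 and y = 0, this is the form
   of degree 2 d in (c, s) equal to
     acc (c^2 + s^2)^d
       + sum_r (c^2 + s^2)^(d - r) (a_r Re (c + i s)^(2 r) + b_r Im (c + i s)^(2 r)). *)
Fixpoint trig_form (T : Type) (add mul : T -> T -> T) (const : Z -> T) (c s : T)
    (h : seq (Z * Z)) (x y acc : T) : T :=
  if h is (a, b) :: h' then
    let u := add (mul c c) (mul (const (-1)) (mul s s)) in
    let v := mul (const 2) (mul c s) in
    let x' := add (mul x u) (mul (const (-1)) (mul y v)) in
    let y' := add (mul x v) (mul y u) in
    trig_form add mul const c s h' x' y'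
      (add (mul acc (add (mul c c) (mul s s)))
        (add (mul (const a) x') (mul (const b) y')))
  else acc.

Definition trig_formR (R : realType) := trig_form +%R *%R (@ZtoR R).
Definition trig_formZ := trig_form zadd zmul (fun z => [:: z]).

Lemma zhorner_const (R : realType) x (t : R) : zhorner [:: x] t = ZtoR x.
Proof. by rewrite /= mulr0 addr0. Qed.

Arguments zadd : simpl never.
Arguments zmul : simpl never.

Lemma zhorner_trig_form (R : realType) c s h x y acc (t : R) :
  zhorner (trig_formZ c s h x y acc) t =
  trig_formR (zhorner c t) (zhorner s t) h (zhorner x t) (zhorner y t) (zhorner acc t).
Proof.
rewrite /trig_formZ /trig_formR.
elim: h x y acc => [|[a b] h IH] x y acc //=.
by rewrite IH !(zhorner_add, zhorner_mul, zhorner_const).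
Qed.

(** Since positive scaling preserves the sign, nonnegativity on a cone can be tested on any curve
    that crosses all its rays. The exponent [j], the degree reached so far, generalises the
    induction. *)
Lemma trig_form_homog (R : realType) (k c s : R) h x y acc j :
  trig_formR (k * c) (k * s) h (k ^+ j * x) (k ^+ j * y) (k ^+ j * acc) =
  k ^+ (j + 2 * size h) * trig_formR c s h x y acc.
Proof.
rewrite /trig_formR.
elim: h x y acc j => [|[a b] h IH] x y acc j /=; first by rewrite addn0.
rewrite (_ : (j + 2 * (size h).+1 = j.+2 + 2 * size h)%N); last by rewrite mulnS addnA addn2.
rewrite -IH !exprS; congr (trig_form +%R *%R _ _ _ _ _ _ _); ring.
Qed.

Definition trig_sum (R : realType) (h : seq (Z * Z)) (x : R) : R :=
  \sum_(i < size h) (ZtoR (nth (0, 0) h i).1 * cos ((2 * i.+1)%:R * x)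
                   + ZtoR (nth (0, 0) h i).2 * sin ((2 * i.+1)%:R * x)).

(** Each round of the recursion adds the angle 2x to the pair (cos 2jx, sin 2jx), and cos^2 + sin^2
    = 1 removes the homogenising factors. *)
Lemma trig_form_angle (R : realType) (h : seq (Z * Z)) (m x : R) (j : nat) :
  trig_formR (cos x) (sin x) h (cos ((2 * j)%:R * x)) (sin ((2 * j)%:R * x)) m =
  m + \sum_(i < size h)
        (ZtoR (nth (0, 0) h i).1 * cos ((2 * (j + i).+1)%:R * x)
       + ZtoR (nth (0, 0) h i).2 * sin ((2 * (j + i).+1)%:R * x)).
Proof.
rewrite /trig_formR.
elim: h j m => [|[a b] h IH] j m; first by rewrite big_ord0 addr0.
rewrite big_ord_recl /= addn0.
under eq_bigr do rewrite /bump add1n addnS -addSn.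
have cx : cos (2 * x) = cos x * cos x - sin x * sin x by rewrite mulr_natl mulr2n cosD.
have sx : sin (2 * x) = 2 * (cos x * sin x) by rewrite mulr_natl mulr2n sinD; ring.
have e2x : (2 * j.+1)%:R * x = (2 * j)%:R * x + 2 * x by rewrite mulnS addnC natrD mulrDl.
rewrite [RHS]addrA -IH e2x cosD sinD cx sx ZtoRN1 (_ : ZtoR 2 = 2) // -!expr2 cos2Dsin2.
congr (trig_form +%R *%R _ _ _ _ _ _ _); ring.
Qed.

Lemma trig_formE (R : realType) (h : seq (Z * Z)) (m x : R) :
  trig_formR (cos x) (sin x) h 1 0 m = m + trig_sum h x.
Proof. by rewrite -(trig_form_angle _ _ _ 0) mul0r cos0 sin0. Qed.

(* The cuts are at tan x = 3, x = pi / 2 and tan x = -3, where x = pi a / n;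
   so a / n is cut at about 0.3976, 0.5 and 0.6024. *)
Definition arc (R : realType) (x : R) : nat :=
  if 0 <= cos x then (if sin x <= 3 * cos x then 0%N else 1%N)
  else (if - (3 * cos x) <= sin x then 2%N else 3%N).

(* The j-th entry (c, s) makes k (c(t), s(t)), k > 0 and 0 <= t <= 1, run over
   the cone of the j-th arc. *)
Definition arc_pieces : seq (seq Z * seq Z) :=
  [:: ([:: 1], [:: 0; 3]); ([:: 0; 1], [:: 3]);
      ([:: 0; -1], [:: 3]); ([:: -1], [:: 0; 3])].

(** The candidate minimum m_j enters through the initial accumulator, hence as the term - m_j (c^2 +
    s^2)^d; 10 is the bisection depth allowed. *)
Definition arc_check (h : seq (Z * Z)) (ms : seq Z) : bool :=
  all (fun j => let cs := nth ([::], [::]) arc_pieces j in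
         znonneg 10 (trig_formZ cs.1 cs.2 h [:: 1] [:: 0] [:: - nth 0 ms j]))
      (iota 0 4).

Lemma arcP (R : realType) (x : R) : 0 <= sin x ->
  exists k t : R, [/\ 0 < k, 0 <= t <= 1,
    cos x = k * zhorner (nth ([::], [::]) arc_pieces (arc x)).1 t
  & sin x = k * zhorner (nth ([::], [::]) arc_pieces (arc x)).2 t].
Proof.
move=> s_ge0; have := cos2Dsin2 x; rewrite /arc.
have Z3 : ZtoR 3 = 3 :> R by [].
have Z1 : ZtoR 1 = 1 :> R by [].
move: (cos x) (sin x) s_ge0 => c s s_ge0 cs1.
have [c_ge0|c_lt0] := lerP 0 c.
  have [s_le|s_gt] := lerP s (3 * c).
    have c_gt0 : 0 < c.
      rewrite lt_neqAle c_ge0 andbT eq_sym; apply/eqP => c0.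
      by move: cs1 s_le; rewrite c0 mulr0 => + s_le; rewrite (_ : s = 0); lra.
    exists c, (s / (3 * c)); rewrite /= ?ZtoR0 Z1 Z3 ?mulr0 ?addr0; split => //.
    - by rewrite divr_ge0 ?mulr_ge0 //= ler_pdivrMr ?mul1r ?mulr_gt0.
    - ring.
    - by field; rewrite gt_eqF.
  have s_gt0 : 0 < s by apply: le_lt_trans s_gt; rewrite mulr_ge0.
  exists (s / 3), (3 * c / s); rewrite /= ?ZtoR0 Z1 Z3 ?mulr0 ?addr0; split => //.
  - by rewrite divr_gt0.
  - by rewrite divr_ge0 ?mulr_ge0 //= ler_pdivrMr ?mul1r ?ltW.
  - by field; rewrite gt_eqF.
  - by field.
have [s_ge|s_lt] := lerP (- (3 * c)) s.
  have s_gt0 : 0 < s by lra.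
  exists (s / 3), (- (3 * c) / s); rewrite /= ?ZtoR0 ZtoRN1 Z3 ?mulr0 ?addr0; split => //.
  - by rewrite divr_gt0.
  - by rewrite divr_ge0 //= ?ler_pdivrMr ?mul1r //; lra.
  - by field; rewrite gt_eqF.
  - by field.
exists (- c), (s / (- (3 * c))); rewrite /= ?ZtoR0 ZtoRN1 Z3 ?mulr0 ?addr0; split => //.
- lra.
- by apply/andP; split; [rewrite divr_ge0 //; lra | rewrite ler_pdivrMr ?mul1r; lra].
- ring.
- by field; rewrite lt_eqF.
Qed.

Lemma arc_lt4 (R : realType) (x : R) : (arc x < 4)%N.
Proof. by rewrite /arc; case: ifP => _; case: ifP. Qed.

Lemma arc_checkP (R : realType) h ms (x : R) : arc_check h ms -> 0 <= sin x ->
  ZtoR (nth 0 ms (arc x)) <= trig_sum h x.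
Proof.
move=> /allP/(_ (arc x)); rewrite mem_iota arc_lt4 => /(_ isT) + /arcP[k [t [k_gt0 t01 cE sE]]].
move=> /znonnegP/(_ t01); rewrite zhorner_trig_form !zhorner_const ZtoR0.
rewrite -mulN1r ZtoRM ZtoRN1 mulN1r => form_ge0.
rewrite -subr_ge0 addrC -trig_formE cE sE.
have := trig_form_homog k (zhorner (nth ([::], [::]) arc_pieces (arc x)).1 t)
  (zhorner (nth ([::], [::]) arc_pieces (arc x)).2 t) h 1 0
  (- ZtoR (nth 0 ms (arc x))) 0.
by rewrite !expr0 !mul1r => ->; rewrite mulr_ge0 ?exprn_ge0 // ltW.
Qed.

(* Found by linear programming: approximate optima, times 1000, of the dual
   problems at p = (.5, .3, .2, 0), (.74, .07, .13, .06) and (.8, .02, .08, .1). *)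
Definition testA : seq (Z * Z) := [:: (-189, 552); (350, 85); (49, -28)].
Definition testB : seq (Z * Z) := [:: (63, 644); (263, 5); (53, 0); (30, -21)].
Definition testC : seq (Z * Z) := [:: (198, 621); (111, -72); (113, 88); (28, -68)].

Lemma testA_arc : arc_check testA [:: 207; 488; 42; -987].
Proof. by lazy. Qed.
Lemma testB_arc : arc_check testB [:: 407; 176; -378; -892].
Proof. by lazy. Qed.
Lemma testC_arc : arc_check testC [:: 448; -173; -673; -674].
Proof. by lazy. Qed.

(** * Counting representations and the excess *)

Definition basis2 (s : seq nat) (n : nat) : Prop :=
  forall m, (m < n)%N -> exists a b, [/\ a \in s, b \in s & m = (a + b)%N].

Lemma sum_seq1_ge (R : realType) (s : seq nat) (F : nat -> R) a :
  (forall i, 0 <= F i) -> a \in s -> F a <= \sum_(i <- s) F i.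
Proof.
move=> F_ge0 a_in; rewrite (big_rem a) //= lerDl.
by rewrite sumr_ge0.
Qed.

(* Every m < n has either two ordered representations as a sum, or a single
   one a + a, which the diagonal sum counts a second time. *)
Lemma double_cover (R : realType) (s : seq nat) (n : nat) (w : nat -> R) :
  uniq s -> basis2 s n -> (forall m, 0 <= w m) ->
  \sum_(m < n) 2 * w m
    <= \sum_(a <- s) \sum_(b <- s) w (a + b)%N + \sum_(a <- s) w (a + a)%N.
Proof.
move=> s_uniq cov w_ge0.
pose e (k m : nat) : R := (k == m)%:R.
have e_ge0 k m : 0 <= e k m by rewrite ler0n.
have pick_le k : \sum_(m < n) e k m * w m <= w k.
  have [k_lt|k_ge] := ltnP k n.
    rewrite (bigD1 (Ordinal k_lt)) //= /e eqxx mul1r big1 ?addr0 // => i.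
    by rewrite -val_eqE /= eq_sym => /negPf ->; rewrite mul0r.
  rewrite big1 // => i _; rewrite /e gtn_eqF ?mul0r //.
  exact: leq_trans (ltn_ord i) k_ge.
have rep (m : 'I_n) :
    2 <= \sum_(a <- s) \sum_(b <- s) e (a + b)%N m + \sum_(a <- s) e (a + a)%N m.
  have [a [b [a_in b_in mE]]] := cov _ (ltn_ord m).
  have row_ge a' b' : b' \in s -> (a' + b' = m)%N -> 1 <= \sum_(b <- s) e (a' + b)%N m.
    move=> b'_in mE'; apply: le_trans (@sum_seq1_ge _ s (fun b => e (a' + b)%N m) b' _ b'_in) => //.
    by rewrite /e mE' eqxx.
  have row_ge0 a' : 0 <= \sum_(b <- s) e (a' + b)%N m by rewrite sumr_ge0.
  have [ab|ab] := eqVneq a b.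
    rewrite -[2](natrD _ 1 1) lerD //.
      apply: le_trans (sum_seq1_ge row_ge0 a_in).
      by apply: row_ge b_in _.
    apply: le_trans (@sum_seq1_ge _ s (fun a => e (a + a)%N m) a _ a_in) => //.
    by rewrite /e mE {2}ab eqxx.
  rewrite -[2]addr0 lerD ?sumr_ge0 // (big_rem a) //= -[2](natrD _ 1 1) lerD //.
    by apply: row_ge b_in _.
  apply: le_trans (sum_seq1_ge row_ge0 (_ : b \in rem a s)).
    by apply: row_ge a_in _; rewrite addnC.
  by rewrite mem_rem_uniq // inE eq_sym ab.
apply: (@le_trans _ _ (\sum_(m < n)
    (\sum_(a <- s) \sum_(b <- s) e (a + b)%N m + \sum_(a <- s) e (a + a)%N m) * w m)).
  by apply: ler_sum => m _; rewrite ler_wpM2r.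
under eq_bigr do rewrite mulrDl.
rewrite big_split lerD //=.
  under eq_bigr do rewrite mulr_suml.
  rewrite exchange_big ler_sum //= => a _.
  under eq_bigr do rewrite mulr_suml.
  by rewrite exchange_big ler_sum.
under eq_bigr do rewrite mulr_suml.
by rewrite exchange_big ler_sum.
Qed.

(* The term 2 k instead of k absorbs the diagonal a + a. *)
Definition excess (R : realType) (s : seq nat) (n : nat) : R :=
  (size s)%:R ^+ 2 + 2 * (size s)%:R - 2 * n%:R.

(** Apply [double_cover] to the nonnegative weight 1 - g: its total over m < n is n, and the
    diagonal costs at most 2 per element. *)
Lemma sum_le_excess (R : realType) (s : seq nat) (n : nat) (g : nat -> R) :
  uniq s -> basis2 s n -> (forall m, `|g m| <= 1) -> \sum_(m < n) g m = 0 ->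
  \sum_(a <- s) \sum_(b <- s) g (a + b)%N <= excess R s n.
Proof.
move=> s_uniq cov g_le1 g_sum0.
have g_bnd m : -1 <= g m <= 1 by rewrite -ler_norml.
have := @double_cover R s n (fun m => 1 - g m) s_uniq cov.
have -> : \sum_(m < n) 2 * (1 - g m) = 2 * n%:R.
  by rewrite -mulr_sumr sumrB g_sum0 subr0 sumr_const card_ord.
have -> : \sum_(a <- s) \sum_(b <- s) (1 - g (a + b)%N) =
    (size s)%:R ^+ 2 - \sum_(a <- s) \sum_(b <- s) g (a + b)%N.
  under eq_bigr do rewrite sumrB big_const_seq count_predT iter_addr_0.
  by rewrite sumrB big_const_seq count_predT iter_addr_0 -natrX -mulnn mulrnA.
have diag : \sum_(a <- s) (1 - g (a + a)%N) <= 2 * (size s)%:R.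
  apply: (@le_trans _ _ (\sum_(a <- s) 2)).
    by apply: ler_sum => a _; case/andP: (g_bnd (a + a)%N); lra.
  by rewrite big_const_seq count_predT iter_addr_0 mulr_natr.
move=> H; have {}H : 2 * n%:R <= (size s)%:R ^+ 2
    - \sum_(a <- s) \sum_(b <- s) g (a + b)%N + \sum_(a <- s) (1 - g (a + a)%N).
  by apply: H => m; case/andP: (g_bnd m); rewrite subr_ge0.
rewrite /excess; lra.
Qed.

(** * Fourier coefficients of the set *)

Definition half_angle (R : realType) (n a : nat) : R := pi * a%:R / n%:R.

Lemma sum_trig_period (R : realType) (n r : nat) : (0 < r < n)%N ->
  \sum_(m < n) cos ((2 * r)%:R * half_angle R n m) = 0 /\
  \sum_(m < n) sin ((2 * r)%:R * half_angle R n m) = 0.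
Proof.
case/andP=> r_gt0 r_lt; have n_gt0 : (0 < n)%N by apply: leq_trans r_lt.
have nR : n%:R != 0 :> R by rewrite pnatr_eq0 -lt0n.
pose d : R := half_angle R n r.
have angE m : (2 * r)%:R * half_angle R n m = 2 * m%:R * d.
  by rewrite /d /half_angle natrM; field.
have sd_neq0 : sin d != 0.
  rewrite gt_eqF // sin_gt0_pi // /d /half_angle !mulr_gt0 ?invr_gt0 ?pi_gt0 ?ltr0n //=.
  by rewrite ltr_pdivrMr ?ltr0n // ltr_pM2l ?pi_gt0 // ltr_nat.
have endE : (2 * n%:R - 1) * d = - d + pi *+ 2 *+ r.
  by rewrite -[pi *+ 2 *+ r]mulr_natr -[pi *+ 2]mulr_natr /d /half_angle; field.
have prevE m : (2 * m%:R - 1) * d = 2 * m%:R * d - d by ring.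
have nextE m : (2 * m.+1%:R - 1) * d = 2 * m%:R * d + d by rewrite -natr1; ring.
have startE : (2 * 0%:R - 1) * d = - d by ring.
(* Multiplied by 2 sin d, each term becomes a difference F(x + d) - F(x - d), so the sum telescopes;
   its two end points differ by r full turns. *)
have telescope (f F : R -> R) : (forall x, 2 * sin d * f x = F (x + d) - F (x - d)) ->
    F (- d + pi *+ 2 *+ r) = F (- d) ->
    \sum_(m < n) f ((2 * r)%:R * half_angle R n m) = 0.
  move=> fF Fend; apply: (mulfI (mulf_neq0 (_ : 2 != 0) sd_neq0)); first by rewrite pnatr_eq0.
  rewrite mulr0 mulr_sumr; under eq_bigr do rewrite fF angE -nextE -prevE.
  rewrite -(big_mkord xpredT (fun m => F ((2 * m.+1%:R - 1) * d) - F ((2 * m%:R - 1) * d))).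
  rewrite (telescope_sumr (fun m => F ((2 * m%:R - 1) * d))) //.
  by rewrite endE startE Fend subrr.
split.
  apply: (telescope cos sin) => [x|].
    by rewrite sinD sinB; ring.
  exact: (periodicn (@sinD2pi R)).
apply: (telescope sin (fun x => - cos x)) => [x|].
  by rewrite cosD cosB; ring.
congr (- _); exact: (periodicn (@cosD2pi R)).
Qed.

Lemma norm_trig_le1 (R : realType) (u v x : R) :
  u ^+ 2 + v ^+ 2 <= 1 -> `|u * cos x + v * sin x| <= 1.
Proof.
move=> uv; rewrite -(@ler_pXn2r _ 2) ?nnegrE // expr1n real_normK ?num_real //.
have := cos2Dsin2 x; have := sqr_ge0 (u * sin x - v * cos x).
nra.
Qed.

Definition cos_sum (R : realType) (s : seq nat) (n r : nat) : R :=
  \sum_(a <- s) cos ((2 * r)%:R * half_angle R n a).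
Definition sin_sum (R : realType) (s : seq nat) (n r : nat) : R :=
  \sum_(a <- s) sin ((2 * r)%:R * half_angle R n a).

(** The double sum of e(r(a + b) / n) is f(r)^2. Testing [sum_le_excess] with u cos + v sin, where
    (u, v) is the direction of f(r)^2, bounds the modulus of f(r)^2, which is C^2 + S^2. *)
Lemma fourier_le (R : realType) (s : seq nat) (n r : nat) :
  uniq s -> basis2 s n -> (0 < r < n)%N ->
  cos_sum R s n r ^+ 2 + sin_sum R s n r ^+ 2 <= excess R s n.
Proof.
move=> s_uniq cov r_bnd.
have [cos0 sin0] := sum_trig_period R r_bnd.
set C := cos_sum R s n r; set S := sin_sum R s n r.
pose ang a := (2 * r)%:R * half_angle R n a.
have angD a b : ang (a + b)%N = ang a + ang b.
  by rewrite /ang /half_angle natrD !(mulrDr, mulrDl).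
have cosE : \sum_(a <- s) \sum_(b <- s) cos (ang (a + b)%N) = C ^+ 2 - S ^+ 2.
  under eq_bigr do under eq_bigr do rewrite angD cosD.
  under eq_bigr do rewrite sumrB -!mulr_sumr.
  by rewrite sumrB -!mulr_suml.
have sinE : \sum_(a <- s) \sum_(b <- s) sin (ang (a + b)%N) = 2 * (C * S).
  under eq_bigr do under eq_bigr do rewrite angD sinD.
  under eq_bigr do rewrite big_split /= -!mulr_sumr.
  rewrite big_split /= -!mulr_suml.
  by rewrite -[\sum_(a <- s) cos (ang a)]/C -[\sum_(a <- s) sin (ang a)]/S; ring.
have D_ge0 : 0 <= C ^+ 2 + S ^+ 2 by rewrite addr_ge0 ?sqr_ge0.
have lin (u v : R) : u ^+ 2 + v ^+ 2 <= 1 ->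
    u * (C ^+ 2 - S ^+ 2) + v * (2 * (C * S)) <= excess R s n.
  move=> uv; rewrite -cosE -sinE !mulr_sumr -big_split /=.
  under eq_bigr do rewrite !mulr_sumr -big_split /=.
  apply: (@sum_le_excess R s n (fun m => u * cos (ang m) + v * sin (ang m))) => //.
    by move=> m; apply: norm_trig_le1.
  by rewrite big_split /= -!mulr_sumr cos0 sin0 !mulr0 addr0.
(* When f(r) = 0 there is no direction to choose; u = v = 0 shows that the excess is nonnegative. *)
have [D0|D_neq0] := eqVneq (C ^+ 2 + S ^+ 2) 0.
  by have := lin 0 0; rewrite D0 !mul0r addr0; apply; rewrite expr0n addr0 ler01.
have sqD : (C ^+ 2 + S ^+ 2) ^+ 2 = (C ^+ 2 - S ^+ 2) ^+ 2 + (2 * (C * S)) ^+ 2 by ring.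
move: (C ^+ 2 + S ^+ 2) (C ^+ 2 - S ^+ 2) (2 * (C * S)) D_neq0 sqD lin => D x y D_neq0 sqD lin.
have -> : D = x / D * x + y / D * y.
  by rewrite mulrAC [y / D * y]mulrAC -!expr2 -mulrDl -sqD expr2 mulfK.
by apply: lin; rewrite !expr_div_n -mulrDl -sqD divff ?expf_neq0.
Qed.

(** * Pairs whose sum overflows n *)

(** If x + y < pi, then sin (x + y) >= 0, whereas sin x cos y + cos x sin y is negative for the
    listed pairs of arcs. *)
Lemma arc_sum_ge_pi (R : realType) (x y : R) :
  0 <= x < pi -> 0 <= y < pi ->
  [|| (1 < arc x)%N && (1 < arc y)%N, (arc x == 1)%N && (arc y == 3)%N
    | (arc x == 3)%N && (arc y == 1)%N] ->
  pi <= x + y.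
Proof.
move=> x_bnd y_bnd arcs.
have sin_ge0 (z : R) : 0 <= z < pi -> 0 <= sin z.
  by case/andP=> z_ge0 /ltW z_le; rewrite sin_ge0_pi ?z_ge0.
have sin_gt0 (z : R) : 0 <= z < pi -> cos z < 0 -> 0 < sin z.
  case/andP=> z_ge0 z_lt cz; rewrite sin_gt0_pi // z_lt andbT lt_neqAle z_ge0 andbT.
  by apply: contraTneq cz => <-; rewrite cos0 ltr10.
rewrite leNgt; apply/negP => xy_lt.
have: 0 <= sin (x + y).
  by rewrite sin_ge0_pi // (ltW xy_lt) andbT addr_ge0 //; [case/andP: x_bnd|case/andP: y_bnd].
rewrite sinD leNgt => /negP; apply; move: arcs; rewrite /arc.
have := sin_ge0 _ x_bnd; have := sin_ge0 _ y_bnd.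
have := sin_gt0 _ x_bnd; have := sin_gt0 _ y_bnd.
move: (sin x) (cos x) (sin y) (cos y) => sx cx sy cy sy_gt0 sx_gt0 sy_ge0 sx_ge0.
(* Arcs 1 and 3: the cuts have opposite slopes, so c s' <= s s' / 3 and s c' < - s s' / 3 add up to
   a negative number. *)
have mixed (s c s' c' : R) : 0 <= s' -> 0 <= c -> 3 * c < s -> s' < - (3 * c') ->
    s * c' + c * s' < 0.
  move=> s'_ge0 c_ge0 cs cs'; have s_gt0 : 0 < s by lra.
  have : 0 < s * (- (3 * c') - s') by rewrite mulr_gt0 // subr_gt0.
  have : 0 <= (s - 3 * c) * s' by rewrite mulr_ge0 // subr_ge0 ltW.
  lra.
have [cx_ge0|cx_lt0] := lerP 0 cx; have [cy_ge0|cy_lt0] := lerP 0 cy.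
- by case: ifP; case: ifP.
- have [|x_far] := lerP sx (3 * cx); have [|y_far] := lerP (- (3 * cy)) sy => //= _.
  exact: mixed.
- have [|x_far] := lerP (- (3 * cx)) sx; have [|y_far] := lerP sy (3 * cy) => //= _.
  by rewrite addrC [cx * _]mulrC [sx * _]mulrC; apply: mixed.
- by move=> _; rewrite -[0]addr0 ltrD // ?(nmulr_llt0 _ cy_lt0) ?(nmulr_rlt0 _ cx_lt0) ?sx_gt0 ?sy_gt0.
Qed.

Definition arc_mass (R : realType) (s : seq nat) (n j : nat) : R :=
  \sum_(a <- s) (arc (half_angle R n a) == j)%:R.

Lemma half_angle_bnd (R : realType) (n a : nat) :
  (a < n)%N -> 0 <= half_angle R n a < pi.
Proof.
move=> a_lt; have n_gt0 : (0 < n)%N by apply: leq_trans a_lt.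
rewrite /half_angle divr_ge0 ?mulr_ge0 ?pi_ge0 //=.
by rewrite ltr_pdivrMr ?ltr0n // ltr_pM2l ?pi_gt0 // ltr_nat.
Qed.

(** The indicator of m >= n sums to zero over m < n, so by [sum_le_excess] the excess bounds the
    number of ordered pairs with a + b >= n; the left side counts pairs of arcs that always
    overflow. *)
Lemma waste_le (R : realType) (s : seq nat) (n : nat) :
  uniq s -> basis2 s n -> {in s, forall a, (a < n)%N} ->
  (arc_mass R s n 2 + arc_mass R s n 3) ^+ 2
    + 2 * (arc_mass R s n 1 * arc_mass R s n 3) <= excess R s n.
Proof.
move=> s_uniq cov s_lt.
pose e j a : R := (arc (half_angle R n a) == j)%:R.
have prodE i j : arc_mass R s n i * arc_mass R s n j =
    \sum_(a <- s) \sum_(b <- s) e i a * e j b.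
  by rewrite mulr_suml; apply: eq_bigr => a _; rewrite mulr_sumr.
have -> : (arc_mass R s n 2 + arc_mass R s n 3) ^+ 2
    + 2 * (arc_mass R s n 1 * arc_mass R s n 3) =
    \sum_(a <- s) \sum_(b <- s) ((e 2 a + e 3 a) * (e 2 b + e 3 b)
       + (e 1 a * e 3 b + e 3 a * e 1 b)).
  transitivity (arc_mass R s n 2 * arc_mass R s n 2 + arc_mass R s n 2 * arc_mass R s n 3
    + (arc_mass R s n 3 * arc_mass R s n 2 + arc_mass R s n 3 * arc_mass R s n 3)
    + (arc_mass R s n 1 * arc_mass R s n 3 + arc_mass R s n 3 * arc_mass R s n 1)).
    by ring.
  rewrite !prodE -!big_split; apply: eq_bigr => a _; rewrite -!big_split.
  by apply: eq_bigr => b _ /=; ring.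
apply: (@le_trans _ _ (\sum_(a <- s) \sum_(b <- s) (n <= a + b)%N%:R)); last first.
  apply: (@sum_le_excess R s n (fun m => (n <= m)%N%:R)) => //.
    by move=> m; rewrite ger0_norm ?ler0n // lern1 leq_b1.
  by rewrite big1 // => m _; rewrite leqNgt ltn_ord.
rewrite big_seq [leRHS]big_seq ler_sum // => a a_in.
rewrite big_seq [leRHS]big_seq ler_sum // => b b_in.
have := arc_sum_ge_pi (half_angle_bnd R (s_lt a a_in)) (half_angle_bnd R (s_lt b b_in)).
have n_gt0 : (0 < n)%N by apply: leq_trans (s_lt a a_in).
rewrite {3 4}/half_angle -mulrDl -mulrDr -natrD ler_pdivlMr ?ltr0n //.
rewrite ler_pM2l ?pi_gt0 // ler_nat /e.
have := arc_lt4 (half_angle R n a); have := arc_lt4 (half_angle R n b).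
case: (arc (half_angle R n a)) => [|[|[|[|//]]]];
case: (arc (half_angle R n b)) => [|[|[|[|//]]]] _ _ /=.
all: rewrite ?(mul0r, mulr0, add0r, addr0, mulr1, ler0n) //.
all: by move=> ->.
Qed.

(** * Optimisation over the arc masses *)

(** The masses are divided by k, and r stands for sqrt M / k. The bound 411 / 2000 slightly exceeds
    the square root of 211 / 5000; 1002 and 1003 are the sums of the rounded-up moduli of the test
    coefficients. *)
Lemma masses_bound_unit (R : realFieldType) (p1 p2 p3 p4 r : R) :
  0 <= p1 -> 0 <= p2 -> 0 <= p3 -> 0 <= p4 -> p1 + p2 + p3 + p4 = 1 ->
  r <= 411 / 2000 ->
  207 * p1 + 488 * p2 + 42 * p3 - 987 * p4 <= 1002 * r ->
  407 * p1 + 176 * p2 - 378 * p3 - 892 * p4 <= 1002 * r ->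
  448 * p1 - 173 * p2 - 673 * p3 - 674 * p4 <= 1003 * r ->
  211 / 5000 < (p3 + p4) ^+ 2 + 2 * (p2 * p4).
Proof.
move=> p1_ge0 p2_ge0 p3_ge0 p4_ge0 sum1 r_le hA hB hC.
(* (p3 + p4)^2 lies above its tangents and p2 p4 >= p2 b: on a narrow slice of
   p4 the problem becomes a linear programme. *)
have tangent (a b : R) : 0 <= (p3 + p4 - a) ^+ 2 -> b <= p4 ->
    2 * a * (p3 + p4) - a ^+ 2 + 2 * (b * p2)
      <= (p3 + p4) ^+ 2 + 2 * (p2 * p4).
  move=> sq le_b_p4; have := ler_wpM2l p2_ge0 le_b_p4; lra.
(* For small p4 the first two constraints alone bound p3 and p2 from below by
   linear functions of p4, and a convex quadratic in p4 remains. *)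
have [p4_lt|p4_ge] := ltP p4 (44 / 1000).
  have e_ge0 : 0 <= p3 - (219 / 1000 - 248 / 100 * p4) by lra.
  have b_ge0 : 0 <= p2 - (87 / 100 - 34 / 10 * p3 - 563 / 100 * p4) by lra.
  have := mulr_ge0 p4_ge0 b_ge0.
  (* With p2 at its lower bound, raising p3 by e above its own changes the objective by e^2 + (0.438
     - 9.76 p4) e. The coefficient of e is positive for p4 up to about 0.0449, whence the threshold
     0.044. *)
  have : 0 <= 44 / 1000 - p4 by lra.
  move/(mulr_ge0 e_ge0).
  have := sqr_ge0 (p3 - (219 / 1000 - 248 / 100 * p4)).
  (* 0.0256 is close to the minimiser of the remaining quadratic in p4. *)
  have := sqr_ge0 (p4 - 256 / 1000 / 10).
  lra.
have {}tangent a b := tangent a b (sqr_ge0 _).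
have [p4_lt|{}p4_ge] := ltP p4 (60 / 1000).
  by have := tangent (150 / 1000) _ p4_ge; lra.
have [p4_lt|{}p4_ge] := ltP p4 (75 / 1000).
  by have := tangent (203 / 1000) _ p4_ge; lra.
have [p4_lt|{}p4_ge] := ltP p4 (80 / 1000).
  by have := tangent (373 / 2000) _ p4_ge; lra.
have [p4_lt|{}p4_ge] := ltP p4 (85 / 1000).
  by have := tangent (367 / 2000) _ p4_ge; lra.
by have := tangent (1536 / 1000 / 10) _ p4_ge; lra.
Qed.

Lemma masses_bound (R : realFieldType) (k p1 p2 p3 p4 r : R) :
  0 < k -> 0 <= p1 -> 0 <= p2 -> 0 <= p3 -> 0 <= p4 -> p1 + p2 + p3 + p4 = k ->
  r <= 411 / 2000 * k ->
  207 * p1 + 488 * p2 + 42 * p3 - 987 * p4 <= 1002 * r ->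
  407 * p1 + 176 * p2 - 378 * p3 - 892 * p4 <= 1002 * r ->
  448 * p1 - 173 * p2 - 673 * p3 - 674 * p4 <= 1003 * r ->
  211 / 5000 * k ^+ 2 < (p3 + p4) ^+ 2 + 2 * (p2 * p4).
Proof.
move=> k_gt0 p1_ge0 p2_ge0 p3_ge0 p4_ge0 sum_p r_le hA hB hC.
have qE x : x = k * (x / k) by rewrite mulrC divfK // gt_eqF.
have q_ge0 x : 0 <= x -> 0 <= x / k by move=> x_ge0; rewrite divr_ge0 // ltW.
move: p1_ge0 p2_ge0 p3_ge0 p4_ge0 sum_p r_le hA hB hC.
move=> /q_ge0 + /q_ge0 + /q_ge0 + /q_ge0.
rewrite (qE p1) (qE p2) (qE p3) (qE p4) (qE r) !(mulrC k (_ / k)) !mulfK ?gt_eqF //.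
move: (p1 / k) (p2 / k) (p3 / k) (p4 / k) (r / k) => {qE q_ge0} {}p1 {}p2 {}p3 {}p4 {}r.
move=> p1_ge0 p2_ge0 p3_ge0 p4_ge0 sum_p r_le hA hB hC.
have -> : (p3 * k + p4 * k) ^+ 2 + 2 * (p2 * k * (p4 * k)) =
    ((p3 + p4) ^+ 2 + 2 * (p2 * p4)) * k ^+ 2 by ring.
rewrite ltr_pM2r ?exprn_gt0 //; apply: (@masses_bound_unit _ p1 p2 p3 p4 r) => //.
- by apply: (mulIf (lt0r_neq0 k_gt0)); rewrite !mulrDl mul1r.
- by rewrite -(ler_pM2r k_gt0).
- by rewrite -(ler_pM2r k_gt0); lra.
- by rewrite -(ler_pM2r k_gt0); lra.
- by rewrite -(ler_pM2r k_gt0); lra.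
Qed.

(** * From the three tests to the bound for bases *)

(** Integer upper bounds [nu] replace the moduli of the coefficients, so no square root has to be
    computed. *)
Definition norm_check (h : seq (Z * Z)) (nu : seq Z) : bool :=
  all (fun i => let ab := nth (0, 0) h i in let z := nth 0 nu i in
         (0 <= z) && (ab.1 * ab.1 + ab.2 * ab.2 <= z * z)) (iota 0 (size h)).

(** Cauchy-Schwarz in the plane, from Lagrange's identity. *)
Lemma lin2_le (R : realType) (a b x y u r : R) :
  a ^+ 2 + b ^+ 2 <= u ^+ 2 -> x ^+ 2 + y ^+ 2 <= r ^+ 2 -> 0 <= u -> 0 <= r ->
  a * x + b * y <= u * r.
Proof.
move=> ab xy u_ge0 r_ge0; apply: le_trans (ler_norm _) _.
rewrite -(@ler_pXn2r _ 2) ?nnegrE ?mulr_ge0 // real_normK ?num_real // exprMn.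
apply: le_trans (ler_pM _ _ ab xy); rewrite ?addr_ge0 ?sqr_ge0 //.
by rewrite -subr_ge0 (_ : _ - _ = (a * y - b * x) ^+ 2) ?sqr_ge0 //; ring.
Qed.

(** The sum of the test polynomial over [s] is bounded below arc by arc, and above frequency by
    frequency with [lin2_le] and [fourier_le]. The condition [size h < n] keeps the frequencies
    strictly between 0 and n. *)
Lemma test_le (R : realType) (s : seq nat) (n : nat) h ms nu (r : R) :
  arc_check h ms -> norm_check h nu -> (size h < n)%N ->
  uniq s -> basis2 s n -> {in s, forall a, (a < n)%N} ->
  0 <= r -> excess R s n <= r ^+ 2 ->
  \sum_(j < 4) ZtoR (nth 0 ms j) * arc_mass R s n j
    <= \sum_(i < size h) ZtoR (nth 0 nu i) * r.
Proof.
move=> arcs /allP norms h_lt s_uniq cov s_lt r_ge0 exc_le.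
apply: (@le_trans _ _ (\sum_(a <- s) trig_sum h (half_angle R n a))).
  under eq_bigr do rewrite mulr_sumr.
  rewrite exchange_big big_seq [leRHS]big_seq ler_sum //= => a a_in.
  have /andP[x_ge0 /ltW x_le] := half_angle_bnd R (s_lt a a_in).
  apply: le_trans (arc_checkP arcs _); last by rewrite sin_ge0_pi ?x_ge0.
  rewrite (bigD1 (Ordinal (arc_lt4 (half_angle R n a)))) //= eqxx mulr1 big1 ?addr0 // => j.
  by rewrite -val_eqE /= eq_sym => /negPf ->; rewrite mulr0.
rewrite exchange_big ler_sum //= => i _.
rewrite big_split /= -!mulr_sumr.
have := norms i; rewrite mem_iota ltn_ord => /(_ isT) /andP[nu_ge0 /(@ler_ZtoR R)].
rewrite ZtoRD !ZtoRM -!expr2 => nu_le.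
apply: lin2_le nu_le _ (ZtoR_ge0 R nu_ge0) r_ge0.
apply: le_trans exc_le; apply: fourier_le => //=.
by apply: leq_ltn_trans h_lt.
Qed.

Lemma sum_arc_mass (R : realType) (s : seq nat) (n : nat) :
  \sum_(j < 4) arc_mass R s n j = (size s)%:R.
Proof.
rewrite exchange_big /= -sum1_size natr_sum.
apply: eq_bigr => a _.
rewrite (bigD1 (Ordinal (arc_lt4 (half_angle R n a)))) //= eqxx big1 ?addr0 // => j.
by rewrite -val_eqE /= eq_sym => /negPf ->.
Qed.

Lemma le_of_sq (R : realDomainType) (x y : R) : 0 <= y -> x ^+ 2 <= y ^+ 2 -> x <= y.
Proof.
move=> y_ge0; apply: contraTT; rewrite -!ltNge => yx.
by rewrite ltr_pXn2r // nnegrE (le_trans y_ge0) // ltW.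
Qed.

Lemma basis2_bound (R : realType) (s : seq nat) (n : nat) :
  uniq s -> basis2 s n -> {in s, forall a, (a < n)%N} -> (4 < n)%N ->
  n%:R <= 4789%:R / 10 ^+ 4 * (size s)%:R ^+ 2 + (size s)%:R :> R.
Proof.
move=> s_uniq cov s_lt n_gt4.
(* As 211 / 5000 = 1 - 2 (0.4789), this rearranges to the claim. *)
suff : 211 / 5000 * (size s)%:R ^+ 2 <= excess R s n by rewrite /excess; lra.
rewrite leNgt; apply/negP => exc_lt.
have k_gt0 : 0 < (size s)%:R :> R.
  have [a [b [a_in _ _]]] := cov 0%N (ltn_trans (isT : 0 < 4)%N n_gt4).
  by rewrite ltr0n; case: (s) a_in.
have exc_ge0 : 0 <= excess R s n.
  by apply: le_trans (@fourier_le R s n 1 _ _ _); rewrite ?addr_ge0 ?sqr_ge0 ?(ltn_trans _ n_gt4).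
pose r := Num.sqrt (excess R s n).
have sq_r : r ^+ 2 = excess R s n by rewrite sqr_sqrtr.
have r_ge0 : 0 <= r by apply: sqrtr_ge0.
have rr : excess R s n <= r ^+ 2 by rewrite sq_r.
have r_le : r <= 411 / 2000 * (size s)%:R.
  apply: le_of_sq; rewrite ?sq_r.
  by rewrite mulr_ge0 ?divr_ge0 ?ler0n.
  by apply: le_trans (ltW exc_lt) _; rewrite exprMn ler_wpM2r ?sqr_ge0 //; lra.
have n_gt3 : (3 < n)%N by apply: ltn_trans n_gt4.
have := waste_le R s_uniq cov s_lt; have := sum_arc_mass R s n.
(* The longest tests, [testB] and [testC], have four frequencies, whence n > 4. *)
have := test_le testC_arc (isT : norm_check testC [:: 652; 133; 144; 74])
  n_gt4 s_uniq cov s_lt r_ge0 rr.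
have := test_le testB_arc (isT : norm_check testB [:: 648; 264; 53; 37])
  n_gt4 s_uniq cov s_lt r_ge0 rr.
have := test_le testA_arc (isT : norm_check testA [:: 584; 361; 57])
  n_gt3 s_uniq cov s_lt r_ge0 rr.
rewrite !big_ord_recr !big_ord0 /= !ZtoRN !ZtoR_nat !add0r.
have p_ge0 j : 0 <= arc_mass R s n j by rewrite sumr_ge0.
move: (p_ge0 0%N) (p_ge0 1%N) (p_ge0 2%N) (p_ge0 3%N).
move: (arc_mass R s n 0) (arc_mass R s n 1) (arc_mass R s n 2) (arc_mass R s n 3).
move: (excess R s n) {p_ge0} exc_lt {exc_ge0 cov} sq_r r_ge0 {rr} r_le => e e_lt.
move: ((size s)%:R) r k_gt0 e_lt => k r k_gt0 e_lt sq_r r_ge0 r_le.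
move=> p1 p2 p3 p4 p1_ge0 p2_ge0 p3_ge0 p4_ge0 hA hB hC sum_p waste.
move: hA hB hC; rewrite -!mulrDl -!natrD !mulNr => hA hB hC.
have := masses_bound k_gt0 p1_ge0 p2_ge0 p3_ge0 p4_ge0 sum_p r_le hA hB hC.
by rewrite ltNge (le_trans waste (ltW e_lt)).
Qed.

(** * Passage to the limit superior *)

(** Sums below [n2 k] involve only elements below [n2 k], so the others are dropped before
    [basis2_bound] is applied; that bound grows with the size of the set. The term 4 covers
    [n2 k <= 4]. *)
Lemma n2_le (R : realType) (k : nat) :
  (n2 k)%:R <= 4789%:R / 10 ^+ 4 * k%:R ^+ 2 + k%:R + 4 :> R.
Proof.
have c_ge0 : 0 <= 4789%:R / 10 ^+ 4 :> R.
  exact: divr_ge0 (ler0n _ _) (exprn_ge0 _ (ler0n _ _)).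
have bound := @basis2_bound R.
move: (4789%:R / 10 ^+ 4) c_ge0 bound => c c_ge0 bound.
have [[A [cardA covA]] _] := n2P k.
have [n_le|n_gt] := leqP (n2 k) 4.
  have : (n2 k)%:R <= 4 :> R by rewrite (ler_nat R _ 4).
  move=> /le_trans; apply; rewrite lerDr addr_ge0 ?ler0n //.
  by rewrite mulr_ge0 ?exprn_ge0.
pose s := [seq a <- (A : seq nat) | (a < n2 k)%N].
have s_uniq : uniq s by rewrite filter_uniq ?fset_uniq.
have s_lt : {in s, forall a, (a < n2 k)%N} by move=> a; rewrite mem_filter => /andP[].
have cov : basis2 s (n2 k).
  move=> m m_lt; have /imfset2P[a aA [b bA mE]] := covA _ m_lt.
  exists a, b; rewrite !mem_filter; split=> //.
    by apply/andP; split=> //; apply: leq_ltn_trans m_lt; rewrite mE leq_addr.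
  by apply/andP; split=> //; apply: leq_ltn_trans m_lt; rewrite mE leq_addl.
have s_le : (size s)%:R <= k%:R :> R.
  by rewrite ler_nat -cardA size_filter count_size.
apply: le_trans (bound _ _ s_uniq cov s_lt n_gt) _.
rewrite -[leLHS]addr0 !lerD //.
by rewrite ler_wpM2l // ler_pXn2r ?nnegrE.
Qed.

Theorem theorem2 (R : realType) :
  (limn_esup (fun k : nat => ((n2 k)%:R / k%:R ^+ 2 : R)%:E)
     <= (4789%:R / 10 ^+ 4 : R)%:E)%E.
Proof.
have := n2_le R; move: (4789%:R / 10 ^+ 4 : R) => c n2_bound.
apply/lee_addgt0Pr => e e_gt0.
(* For k >= 1 the error k + 4 is at most 5 k, and 5 k <= e k^2 once k > 5 / e. *)
pose N := Num.bound (5 / e).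
have N_gt : 5 / e < N%:R by apply: archi_boundP; rewrite divr_ge0 // ltW.
(* The limit superior is an infimum of suprema, and the tail k >= N is one of the candidates. *)
apply: (@le_trans _ _ (ereal_sup [set ((n2 k)%:R / k%:R ^+ 2 : R)%:E | k in [set k | (N <= k)%N]]%classic)).
  by apply: ereal_inf_lbound; exists [set k | (N <= k)%N]%classic => //; exists N.
apply: ge_ereal_sup => _ [k /= N_le <-].
have k_gt : 5 / e < k%:R :> R by apply: lt_le_trans N_gt _; rewrite ler_nat.
have k_gt0 : 0 < k%:R :> R by apply: lt_trans k_gt; rewrite divr_gt0.
have k_ge1 : 1 <= k%:R :> R by rewrite ler1n -(ltr0n R).
rewrite -EFinD lee_fin ler_pdivrMr ?exprn_gt0 // mulrDl.
apply: le_trans (n2_bound k) _; rewrite -addrA lerD2l.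
have : 5 * k%:R <= k%:R * e * k%:R by rewrite ler_pM2r // ltW // -ltr_pdivrMr.
lra.
Qed.
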